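(* Let $(r_k)_{k\ge 1}$, $(s_k)_{k\ge 0}$, $(t_k)_{k\ge 1}$ be sequences of nonnegative real numbers, and let $A=[a_{n,k}]_{n,k\ge 0}$ be the infinite lower triangular matrix with $a_{n,k}=0$ unless $n\ge k\ge 0$, defined by $$a_{0,0}=1,\quad a_{n+1,0}=s_0a_{n,0}+t_1a_{n,1},\quad a_{n+1,k}=r_{k}a_{n,k-1}+s_ka_{n,k}+t_{k+1}a_{n,k+1}\quad (k\ge 1,\ n\ge 0).$$ If $s_0\ge 1$ and $s_k\ge r_kt_k+1$ for all $k\ge 1$, then $A$ is TP.
   Context: A real (finite or infinite) matrix is TP (totally positive) if its minors of all orders are nonnegative. *)

(* Defs.v *)
From mathcomp Require Import all_boot all_order all_algebra.
From mathcomp Require Import reals.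

Set Implicit Arguments.
Unset Strict Implicit.
Unset Printing Implicit Defensive.

Import Order.TTheory GRing.Theory Num.Theory.
Local Open Scope ring_scope.

(* An infinite matrix with rows and columns indexed by 0, 1, 2, ... is a
   function nat -> nat -> R. A minor is given by strictly increasing row and
   column indices; the empty minor (m = 0) has determinant 1. *)
Definition strictly_increasing (m : nat) (f : 'I_m -> nat) : Prop :=
  forall i j : 'I_m, (i < j)%N -> (f i < f j)%N.

Definition minor (R : realType) (A : nat -> nat -> R) (m : nat)
    (f g : 'I_m -> nat) : R :=
  \det (\matrix_(i < m, j < m) A (f i) (g j)).

Definition totally_positive (R : realType) (A : nat -> nat -> R) : Prop :=
  forall (m : nat) (f g : 'I_m -> nat),
    strictly_increasing f -> strictly_increasing g -> 0 <= minor A f g.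

(* Main.v *)
Require Import Defs.
From mathcomp Require Import all_boot all_order all_algebra.
From mathcomp Require Import perm.
From mathcomp Require Import reals.

Set Implicit Arguments.
Unset Strict Implicit.
Unset Printing Implicit Defensive.

Import Order.TTheory GRing.Theory Num.Theory.
Local Open Scope ring_scope.

(** The recurrence says that deleting row 0 of [A] gives [A J], where [J] is
the tridiagonal matrix with entries [r_k] above, [s_k] on and [t_k] below the
diagonal. The hypotheses on [s] make every pivot [d_k] of [J], given by
[d_0 = s_0] and [d_(k+1) = s_(k+1) - r_(k+1) t_(k+1) / d_k], at least 1
([pivot_ge1]), so [J = L U] with [L] lower and [U] upper bidiagonal, both
having nonnegative entries.

Multiplying on the right by a nonnegative bidiagonal matrix preserves the
nonnegativity of the minors on a given set of rows: by multilinearity in the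
columns ([det_sum_cols]) a minor of the product is a nonnegative combination
of determinants whose columns are taken from the old matrix in weakly
increasing order, and each of these is a minor or has two equal columns
([nonneg_minors_col_comb]).

Finally the minors of [A] are handled by induction on their order and on their
first row index. If row 0 of [A], which is (1, 0, 0, ...), occurs, expanding
along it lowers the order; otherwise the minor is a minor of [A L U] with all
row indices lowered by one. *)

(** Multilinearity of the determinant in all its columns at once. *)
Lemma det_sum_cols (R : comNzRingType) (K : finType) (m : nat)
    (c : 'I_m -> K -> R) (F : 'I_m -> 'I_m -> K -> R) :
  \det (\matrix_(i, j) \sum_(b : K) c j b * F i j b) =
  \sum_(e : {ffun 'I_m -> K})
    (\prod_j c j (e j)) * \det (\matrix_(i, j) F i j (e j)).
Proof.
rewrite -det_tr [LHS]/determinant.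
transitivity (\sum_(p : 'S_m) \sum_(e : {ffun 'I_m -> K})
   (-1) ^+ p * \prod_j (c j (e j) * F (p j) j (e j))).
  apply: eq_bigr => p _; rewrite -big_distrr /=; congr (_ * _).
  rewrite -(bigA_distr_bigA (fun j b => c j b * F (p j) j b)).
  by apply: eq_bigr => j _; rewrite !mxE.
rewrite exchange_big /=; apply: eq_bigr => e _.
rewrite -[in RHS]det_tr /determinant big_distrr /=; apply: eq_bigr => p _.
rewrite big_split /= mulrCA; congr (_ * (_ * _)).
by apply: eq_bigr => j _; rewrite !mxE.
Qed.

Section ColumnOperations.

Variable R : realType.
Implicit Types (X Y : nat -> nat -> R) (m : nat).

(** All minors of [X] on the rows [f] are nonnegative. Keeping the rows fixed
allows row-by-row induction. *)
Definition nonneg_minors X m (f : 'I_m -> nat) : Prop :=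
  forall g : 'I_m -> nat, strictly_increasing g -> 0 <= minor X f g.

Lemma nonneg_minors_weak X m (f g : 'I_m -> nat) :
  nonneg_minors X f -> (forall i j : 'I_m, (i < j)%N -> (g i <= g j)%N) ->
  0 <= minor X f g.
Proof.
move=> Xf gle.
have [/existsP[i /existsP[j /andP[ltij /eqP eqg]]]|/existsPn noeq] :=
  boolP [exists i : 'I_m, exists j : 'I_m, (i < j)%N && (g i == g j)].
  rewrite /minor -det_tr (@determinant_alternate _ _ _ i j) //.
    by apply: contraTneq ltij => ->; rewrite ltnn.
  by move=> k; rewrite !mxE eqg.
apply: Xf => i j ltij; rewrite ltn_neqAle gle // andbT.
by move/existsPn: (noeq i) => /(_ j); rewrite ltij.
Qed.

(** The map [h] tells which columns of [X] contribute to column [k] of [Y]. The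
cases of interest are the products by an upper bidiagonal matrix
(columns [k - 1] and [k]) and a lower bidiagonal one (columns [k] and
[k + 1]). *)
Lemma nonneg_minors_col_comb X Y (K : finType) (c : nat -> K -> R)
    (h : nat -> K -> nat) m (f : 'I_m -> nat) :
  (forall k b, 0 <= c k b) ->
  (forall k l b b', (k < l)%N -> (h k b <= h l b')%N) ->
  (forall n k, Y n k = \sum_b c k b * X n (h k b)) ->
  nonneg_minors X f -> nonneg_minors Y f.
Proof.
move=> c0 hle YE Xf g ginc; rewrite /minor.
under eq_mx do rewrite YE.
rewrite (@det_sum_cols _ _ _ (fun j => c (g j))
  (fun i j b => X (f i) (h (g j) b))).
apply: sumr_ge0 => e _; apply: mulr_ge0; first exact: prodr_ge0.
apply: (nonneg_minors_weak (g := fun j => h (g j) (e j)) Xf) => i j ltij.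
exact/hle/ginc.
Qed.

End ColumnOperations.

(** The pivots in the Gaussian elimination of the tridiagonal matrix with
entries [r_k], [s_k], [t_k]. *)
Fixpoint pivot (R : realType) (r s t : nat -> R) (k : nat) : R :=
  if k is l.+1 then s k - r k * t k / pivot r s t l else s 0.

Lemma pivot_ge1 (R : realType) (r s t : nat -> R) :
  (forall k, (1 <= k)%N -> 0 <= r k) -> (forall k, (1 <= k)%N -> 0 <= t k) ->
  1 <= s 0%N -> (forall k, (1 <= k)%N -> r k * t k + 1 <= s k) ->
  forall k, 1 <= pivot r s t k.
Proof.
move=> hr ht hs0 hsk; elim=> [|k IHk] //=.
rewrite lerBrDl; apply: le_trans (hsk k.+1 isT); rewrite lerD2r.
rewrite ler_pdivrMr; last exact: lt_le_trans IHk.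
by rewrite ler_peMr // mulr_ge0 ?hr ?ht.
Qed.

(** A nonnegative tridiagonal matrix with pivots at least 1 preserves
nonnegativity of minors when it multiplies on the right. *)
Lemma nonneg_minors_tridiag (R : realType) (r s t : nat -> R)
    (X Y : nat -> nat -> R) (m : nat) (f : 'I_m -> nat) :
  (forall k, (1 <= k)%N -> 0 <= r k) -> (forall k, (1 <= k)%N -> 0 <= t k) ->
  (forall k, 1 <= pivot r s t k) ->
  (forall n, Y n 0%N = s 0%N * X n 0%N + t 1%N * X n 1%N) ->
  (forall n k, Y n k.+1 =
     r k.+1 * X n k + s k.+1 * X n k.+1 + t k.+2 * X n k.+2) ->
  nonneg_minors X f -> nonneg_minors Y f.
Proof.
move=> hr ht d1 Y0 YS Xf.
set d := pivot r s t in d1 *.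
have d_gt0 k : 0 < d k by exact: lt_le_trans (d1 k).
have d_neq0 k : d k != 0 by rewrite gt_eqF.
(* [l k] is the subdiagonal entry of [L] in column [k]; [XL] is [X L]. *)
pose l k := t k.+1 / d k.
pose XL n k := X n k + l k * X n k.+1.
have dl k : d k * l k = t k.+1 by rewrite mulrC divfK.
have XLf : nonneg_minors XL f.
  apply: (@nonneg_minors_col_comb _ X _ bool (fun k b => if b then l k else 1)
           (fun k b => if b then k.+1 else k)) => //.
  - by move=> k [] //; rewrite divr_ge0 ?ht // ltW.
  - by move=> k k' [] [] ltk //; apply: ltnW; rewrite ?ltnS // ltnW.
  - by move=> n k; rewrite big_bool /= mul1r addrC.
(* Column 0 of [U] has no entry above the diagonal: its coefficient is 0, and
   the truncated predecessor of 0 is harmless. *)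
apply: (@nonneg_minors_col_comb _ XL _ bool
         (fun k b => if b then (if k is 0 then 0 else r k) else d k)
         (fun k b => if b then k.-1 else k)) XLf.
- by move=> [|k] [] //; rewrite ?hr // ltW.
- move=> k k' [] [] ltk; [by rewrite -!subn1 leq_sub2r // ltnW | | | exact: ltnW].
    by rewrite (leq_trans (leq_pred _)) // ltnW.
  by case: k' ltk.
- move=> n [|k]; rewrite big_bool /= /XL.
    by rewrite mul0r add0r Y0 mulrDr mulrA dl.
  have -> : Y n k.+1 = r k.+1 * X n k + (d k.+1 + r k.+1 * l k) * X n k.+1 +
                       d k.+1 * l k.+1 * X n k.+2.
    by rewrite YS dl /l mulrA /= subrK.
  by rewrite mulrDl !mulrDr !mulrA -!addrA; congr (_ + _); rewrite addrCA.
Qed.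

Theorem theorem2p9 (R : realType) (r s t : nat -> R) (a : nat -> nat -> R)
  (hr : forall k : nat, (1 <= k)%N -> 0 <= r k)
  (hs : forall k : nat, 0 <= s k)
  (ht : forall k : nat, (1 <= k)%N -> 0 <= t k)
  (ha_lower : forall n k : nat, (n < k)%N -> a n k = 0)
  (ha00 : a 0%N 0%N = 1)
  (ha_col0 : forall n : nat,
     a n.+1 0%N = s 0%N * a n 0%N + t 1%N * a n 1%N)
  (ha_rec : forall n k : nat, (1 <= k)%N ->
     a n.+1 k = r k * a n k.-1 + s k * a n k + t k.+1 * a n k.+1)
  (hs0 : 1 <= s 0%N)
  (hsk : forall k : nat, (1 <= k)%N -> r k * t k + 1 <= s k) :
  totally_positive a.
Proof.
have d1 := pivot_ge1 hr ht hs0 hsk.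
elim=> [|m IHm] f g; first by rewrite /minor det_mx00 ler01.
move Dn: (f ord0) => n; elim: n f g Dn => [|n IHn] f g f0 finc ginc.
  rewrite /minor (expand_det_row _ ord0) big_ord_recl big1 => [|j _]; last first.
    rewrite mxE f0 ha_lower ?mul0r //.
    exact: leq_ltn_trans (ginc ord0 (lift ord0 j) isT).
  rewrite addr0 mxE f0; apply: mulr_ge0.
    by case: (g ord0) => [|k]; rewrite ?ha00 ?ha_lower.
  rewrite /cofactor addn0 expr0 mul1r.
  have -> : row' ord0 (col' ord0 (\matrix_(i, j) a (f i) (g j))) =
            \matrix_(i, j) a (f (lift ord0 i)) (g (lift ord0 j)).
    by apply/matrixP => i j; rewrite !mxE.
  by apply: (IHm (fun i => f (lift ord0 i)) (fun i => g (lift ord0 i)))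
    => i j ltij; [apply: finc | apply: ginc].
have f_gt0 i : (0 < f i)%N.
  have [->|i_gt0] := eqVneq i ord0; first by rewrite f0.
  by apply: leq_ltn_trans (finc ord0 i _) => //; rewrite lt0n.
have -> : minor a f g = minor (fun n => a n.+1) (fun i => (f i).-1) g.
  by rewrite /minor; congr (\det _); apply/matrixP=> i j; rewrite !mxE prednK.
apply: (nonneg_minors_tridiag (X := a) hr ht d1) ginc => //.
- by move=> n' k; rewrite ha_rec.
move=> g' g'inc; apply: IHn => //; first by rewrite f0.
by move=> i j ltij; rewrite -ltnS !prednK // finc.
Qed.
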